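(* Let $S$ be a closed symmetric operator in a separable Hilbert space $\mathfrak H$, let $\Gamma:\mathfrak H^2\to\mathcal H^2$ be a boundary relation for $S^*$ which satisfies the conditions (B1)–(B3), let $\gamma(\lambda)$ be the corresponding $\gamma$-field, let $\mathcal H=\mathcal H_1\oplus\mathcal H_2$ be an orthogonal decomposition, and decompose the corresponding Weyl function accordingly as $M(\lambda)=(M_{ij}(\lambda))_{i,j=1}^2$. Then: (i) the linear relation $$H^{(1)}=\Big\{\widehat f\in S^*:\Big\{\widehat f,\begin{pmatrix}0\\ h'\end{pmatrix}\Big\}\in\Gamma\text{ for some }h'\in\mathcal H_2\Big\}$$ is closed and symmetric in $\mathfrak H$ and has equal defect numbers; (ii) the linear relation $\Gamma^{(1)}:\mathfrak H^2\to\mathcal H_1^2$ given by $$\Gamma^{(1)}=\Big\{\Big\{\widehat f,\begin{pmatrix}h\\ P_{\mathcal H_1}h'\end{pmatrix}\Big\}:\Big\{\widehat f,\begin{pmatrix}h\\ h'\end{pmatrix}\Big\}\in\Gamma\text{ for some }h\in\mathcal H_1,\ h'\in\mathcal H\Big\}$$ is a boundary relation for $(H^{(1)})^*$ which satisfies the conditions (B1)–(B3); (iii) the domain $T^{(1)}:=\operatorname{dom}\Gamma^{(1)}$ is dense in $(H^{(1)})^*$ and $$T^{(1)}=\{\widehat f\in S^*:\{\widehat f,\widehat h\}\in\Gamma\text{ for some }\widehat h=\{h,h'\}\text{ with }P_{\mathcal H_2}h=0\};$$ (iv) the corresponding $\gamma$-field $\gamma_1(\lambda):\mathcal H_1\to\mathfrak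 H$ and Weyl function $M_1(\lambda)\in[\mathcal H_1]$ of $\Gamma^{(1)}$ are given by $$\gamma_1(\lambda)=\gamma(\lambda)\upharpoonright\mathcal H_1,\qquad M_1(\lambda)=M_{11}(\lambda),\qquad\lambda\in\mathbb C\setminus\mathbb R.$$
   Context: A linear relation from $\mathfrak H_1$ to $\mathfrak H_2$ is a linear subspace of $\mathfrak H_1\times\mathfrak H_2$; $[\mathcal H]$ denotes the bounded everywhere defined operators in $\mathcal H$; $P_{\mathcal H_j}$ is the orthogonal projection of $\mathcal H$ onto $\mathcal H_j$. Write $\widehat f=\{f,f'\}$ etc.; pairs are also written as columns. $S^*$ is the adjoint linear relation. Boundary relation: for a closed symmetric linear relation $S$ in $\mathfrak H$, a linear relation $\Gamma:\mathfrak H^2\to\mathcal H^2$ is a boundary relation for $S^*$ if (G1) $\operatorname{dom}\Gamma$ is dense in $S^*$ and $(f',g)_{\mathfrak H}-(f,g')_{\mathfrak H}=(h',k)_{\mathcal H}-(h,k')_{\mathcal H}$ (Green's identity) for all $\{\widehat f,\widehat h\},\{\widehat g,\widehat k\}\in\Gamma$; (G2) every $\{\widehat g,\widehat k\}\in\mathfrak H^2\times\mathcal H^2$ satisfying this identity for all $\{\widehat f,\widehat h\}\in\Gamma$ belongs to $\Gamma$. Put $\Gamma_0=\{\{\widehat f,h\}:\{\widehat f,\widehat h\}\in\Gamma,\widehat h=\{h,h'\}\}$. The Weyl family is $M(\lambda)=\{\widehat h\in\mathcal H^2:\{\widehat f_\lambda,\widehat h\}\in\Gamma\text{ for some }\widehat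 f_\lambda=\{f,\lambda f\}\}$ and the $\gamma$-field is $\gamma(\lambda)=\{\{h,f_\lambda\}:\{\{f_\lambda,\lambda f_\lambda\},\{h,h'\}\}\in\Gamma\text{ for some }h'\}$, $\lambda\in\mathbb C\setminus\mathbb R$. Conditions (B1)–(B3): (B1) Green's identity holds; (B2) $\operatorname{ran}\Gamma_0=\mathcal H$; (B3) $A_0:=\ker\Gamma_0$ is a selfadjoint linear relation in $\mathfrak H$. Under these conditions $M(\lambda)\in[\mathcal H]$ and $\gamma(\lambda)$ is a bounded everywhere defined operator from $\mathcal H$ to $\mathfrak H$ for every $\lambda\in\mathbb C\setminus\mathbb R$. *)

(* Defs.v *)
From HB Require Import structures.
From mathcomp Require Import all_boot all_order all_algebra.
From mathcomp Require Import complex.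
From mathcomp Require Import all_classical all_reals all_analysis.

Set Implicit Arguments.
Unset Strict Implicit.
Unset Printing Implicit Defensive.

Import Order.TTheory GRing.Theory Num.Theory.
Import numFieldNormedType.Exports.

Local Open Scope classical_set_scope.
Local Open Scope ring_scope.

(* [inner] is linear in its first and conjugate-linear in its second
   argument. *)
HB.mixin Record NormedModule_hasInner (R : realType) V
    & NormedModule R[i] V := {
  inner : {dot V for (@Num.conj R[i])};
  inner_norm : forall x : V, inner x x = `|x| ^+ 2
}.

#[short(type="hilbertType")]
HB.structure Definition Hilbert (R : realType) :=
  { V of CompleteNormedModule R[i] V & NormedModule_hasInner R V }.

Definition separable (T : topologicalType) :=
  exists2 D : set T, countable D & dense D.

Definition linear_subspace (K : pzRingType) (V : lmodType K) (A : set V) :=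
  A 0 /\ forall (a : K) (x y : V), A x -> A y -> A (a *: x + y).

Definition dense_in (T : topologicalType) (A B : set T) :=
  A `<=` B /\ B `<=` closure A.

Structure closed_subspace (R : realType) (V : hilbertType R) := ClosedSubspace {
  carrier :> {pred V};
  carrier_submod : submod_closed carrier;
  carrier_closed : closed [set x | x \in carrier]
}.

(* A closed subspace is itself a Hilbert space. *)
Section ClosedSubspace.
Context {R : realType} {V : hilbertType R}.
Variable K : closed_subspace V.

HB.instance Definition _ :=
  GRing.isSubmodClosed.Build R[i] V (carrier K) (carrier_submod K).

Definition subspace_sort := {x : V | x \in carrier K}.

HB.instance Definition _ := SubChoice.on subspace_sort.
HB.instance Definition _ := [SubChoice_isSubLmodule of subspace_sort by <:].

Let norm (x : subspace_sort) : R[i] := `|\val x|.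

Let ler_normD x y : norm (x + y) <= norm x + norm y.
Proof. by rewrite /norm raddfD ler_normD. Qed.

Let normrZ (a : R[i]) x : norm (a *: x) = `|a| * norm x.
Proof. by rewrite /norm linearZ normrZ. Qed.

Let normr0_eq0 x : norm x = 0 -> x = 0.
Proof. by move=> /normr0_eq0 x0; apply/val_inj; rewrite x0 raddf0. Qed.

HB.instance Definition _ := Lmodule_isNormed.Build R[i] subspace_sort
  ler_normD normrZ normr0_eq0.

Let normB (x y : subspace_sort) : `|x - y| = `|\val x - \val y|.
Proof. by rewrite -raddfB. Qed.

Let complete (F : set_system subspace_sort) :
  ProperFilter F -> cauchy F -> cvg F.
Proof.
move=> FF /cauchy_ballP Fc.
pose G := (\val : subspace_sort -> V) @ F.
have /cauchy_cvgP/cvg_ex[l Gl] : cauchy G.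
  apply/cauchy_ballP => e e0; have := Fc e e0; rewrite !near_simpl/=.
  move=> [[A B] /= [FA FB] AB].
  exists (\val @` A, \val @` B) => /=.
    by split; rewrite /G /fmap /nbhs/=; [apply: filterS FA|apply: filterS FB]
      => x xX; exists x.
  move=> [_ _] /= [[x Ax <-] [y By <-]].
  have := AB (x, y) (conj Ax By).
  by rewrite -!ball_normE /= normB.
have Kl : l \in carrier K.
  have := @closed_cvg _ _ F _ (\val : subspace_sort -> V) _
    (@carrier_closed _ _ K) _ l Gl.
  by apply; apply: nearW => x; exact: valP.
apply/cvg_ex; exists (Sub l Kl : subspace_sort).
apply/cvgrPdist_lt => e e0; move/cvgrPdist_lt : Gl => /(_ e e0).
by apply: filterS => x; rewrite normB.
Qed.

HB.instance Definition _ := Uniform_isComplete.Build subspace_sort complete.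

Definition subspace_inner (x y : subspace_sort) : R[i] :=
  inner (\val x) (\val y).

Let inner_bilinear :
  bilinear_for *%R (@Num.conj R[i] \; *%R) subspace_inner.
Proof.
by split=> z a x y; rewrite /subspace_inner linearP ?linearPl.
Qed.

HB.instance Definition _ := bilinear_isBilinear.Build R[i]
  subspace_sort subspace_sort R[i] *%R (@Num.conj R[i] \; *%R)
  subspace_inner inner_bilinear.

Let inner_hermitian x y :
  subspace_inner x y = (-1) ^+ false * Num.conj (subspace_inner y x).
Proof. exact: hermitian_subproof. Qed.

HB.instance Definition _ := isHermitianSesquilinear.Build R[i]
  subspace_sort false (@Num.conj R[i]) subspace_inner inner_hermitian.

Let inner_gt0 x : x != 0 -> 0 < subspace_inner x x.
Proof. by move=> x0; rewrite /subspace_inner inner_norm exprn_gt0 ?normr_gt0. Qed.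

HB.instance Definition _ := isDotProduct.Build R[i]
  subspace_sort subspace_inner inner_gt0.

Let subspace_inner_norm x : subspace_inner x x = `|x| ^+ 2.
Proof. exact: inner_norm. Qed.

HB.instance Definition _ := NormedModule_hasInner.Build R subspace_sort
  subspace_inner_norm.

End ClosedSubspace.

Coercion subspace_sort : closed_subspace >-> Sortclass.

Section Geometry.
Context {R : realType} {V : hilbertType R}.

Definition orthogonal_decomposition (K1 K2 : closed_subspace V) :=
  (forall (x : K1) (y : K2), inner (\val x) (\val y) = 0) /\
  (forall x : V, exists (x1 : K1) (x2 : K2), x = \val x1 + \val x2).

Definition orthogonal_projection (K : closed_subspace V) (x : V) : K :=
  xget 0 [set y : K | forall z : K, inner (x - \val y) (\val z) = 0].

Definition orthonormal_basis (N B : set V) :=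
  [/\ B `<=` N,
      forall x, B x -> inner x x = 1,
      forall x y, B x -> B y -> x <> y -> inner x y = 0 &
      N `<=` closure (smallest (@linear_subspace _ V) B)].

(* Orthonormal bases of a given closed subspace are equipotent, hence this is
   the equality of the Hilbert space dimensions of N and N'. *)
Definition eq_dimension (N N' : set V) :=
  exists B B', [/\ orthonormal_basis N B, orthonormal_basis N' B' & (B #= B')%card].

End Geometry.

Section Operators.
Context {R : realType} {U V : hilbertType R}.

Definition bounded_operator (A : U -> V) :=
  linear A /\ exists C : R[i], forall x, `|A x| <= C * `|x|.

Definition graph (A : U -> V) : set (U * V) := [set p | p.2 = A p.1].

(* The entry of index (i, j) of the block matrix of an operator with respect to
   decompositions of its domain and its codomain, when [L] is the j-th summand
   of the domain and [K] the i-th summand of the codomain. *)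
Definition block (K : closed_subspace V) (L : closed_subspace U) (A : U -> V) :
  L -> K := fun x => orthogonal_projection K (A (\val x)).

End Operators.

Arguments block {R U V} K L A.

(* A linear relation from U to V is a set (U * V) which is a linear subspace. *)
Section Relations.
Context {R : realType} {U V : lmodType R[i]}.
Implicit Type T : set (U * V).

Definition linear_relation T := linear_subspace T.
Definition rel_dom T : set U := [set x | exists y, T (x, y)].
Definition rel_ran T : set V := [set y | exists x, T (x, y)].
Definition rel_ker T : set U := [set x | T (x, 0)].

(* The relation is the graph of a (not necessarily everywhere defined)
   operator. *)
Definition is_operator T := forall y, T (0, y) -> y = 0.

End Relations.

Section Adjoint.
Context {R : realType} {U V : hilbertType R}.

Definition adjoint (T : set (U * V)) : set (V * U) :=
  [set g | forall f, T f -> inner f.2 g.1 = inner f.1 g.2].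

End Adjoint.

Section SymmetricRelations.
Context {R : realType} {H : hilbertType R}.
Implicit Type T : set (H * H).

Definition symmetric_relation T := T `<=` adjoint T.

Definition selfadjoint_relation T := T = adjoint T.

Definition closed_symmetric_relation T :=
  [/\ linear_relation T, closed T & symmetric_relation T].

Definition defect_subspace T (l : R[i]) : set H :=
  [set f | adjoint T (f, l *: f)].

(* The defect numbers of T are the dimensions of the defect subspaces at
   the points i and -i. *)
Definition equal_defect_numbers T :=
  eq_dimension (defect_subspace T 'i%C) (defect_subspace T (- 'i%C)).

End SymmetricRelations.

Section BoundaryRelations.
Context {R : realType} {H G : hilbertType R}.
Implicit Types (S : set (H * H)) (Gamma : set ((H * H) * (G * G))).

Definition green (p q : (H * H) * (G * G)) :=
  let: ((f, f'), (h, h')) := p in let: ((g, g'), (k, k')) := q in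
  inner f' g - inner f g' = inner h' k - inner h k'.

Definition green_identity Gamma :=
  forall p q, Gamma p -> Gamma q -> green p q.

Definition boundary_relation S Gamma :=
  [/\ linear_relation Gamma,
      dense_in (rel_dom Gamma) (adjoint S),
      green_identity Gamma &
      forall q, (forall p, Gamma p -> green p q) -> Gamma q].

Definition Gamma0 Gamma : set ((H * H) * G) :=
  [set p | exists h', Gamma (p.1, (p.2, h'))].

Definition conditions_B Gamma :=
  [/\ green_identity Gamma,
      rel_ran (Gamma0 Gamma) = setT &
      selfadjoint_relation (rel_ker (Gamma0 Gamma))].

Definition weyl_family Gamma (l : R[i]) : set (G * G) :=
  [set h | exists f, Gamma ((f, l *: f), h)].

Definition gamma_field Gamma (l : R[i]) : set (G * H) :=
  [set p | exists h', Gamma ((p.2, l *: p.2), (p.1, h'))].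

End BoundaryRelations.

Section Reduction.
Context {R : realType} {H G : hilbertType R}.
Variables (S : set (H * H)) (Gamma : set ((H * H) * (G * G))).

Definition reduced_relation (K2 : closed_subspace G) : set (H * H) :=
  [set f | adjoint S f /\ exists h' : K2, Gamma (f, (0, \val h'))].

Definition reduced_boundary_relation (K1 : closed_subspace G) :
    set ((H * H) * (K1 * K1)) :=
  [set p | exists h' : G, Gamma (p.1, (\val p.2.1, h')) /\
     p.2.2 = orthogonal_projection K1 h'].

End Reduction.

Arguments reduced_boundary_relation {R H G} Gamma K1.

(* Main.v *)
Require Import Defs.
From mathcomp Require Import all_boot all_order all_algebra.
From mathcomp Require Import complex ring.
From mathcomp Require Import all_classical all_reals all_analysis.
Import Order.TTheory GRing.Theory Num.Theory.
Import numFieldNormedType.Exports.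
Local Open Scope classical_set_scope.
Local Open Scope ring_scope.

(** Everything takes place around the selfadjoint relation [A0], the kernel of
    [Gamma0 Gamma], which contains the reduced relation [H1] and is contained in
    the domain [T1] of the reduced boundary relation [Gamma1].

    Since [Gamma0 Gamma] is onto, any boundary value [h] can be prescribed, and
    since [A0 - l] is onto for nonreal [l] ([selfadjoint_range]), a correction
    by an element of [A0] turns an element with boundary value [h] into an
    eigenvector [(f, l *: f)] with the same boundary value. Hence the
    [gamma]-field and the Weyl function are functions on the whole space, and
    Green's identity exhibits everywhere defined adjoints of both, so that they
    are bounded by the Hellinger-Toeplitz theorem ([weyl_bounded]). This applies
    to [Gamma] and to [Gamma1], and the inclusion of the [gamma]-field and the
    Weyl family of [Gamma1] in the compressed ones of [Gamma] then is an equality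
    of functions.

    Green's identity and the inclusion of [A0] in [T1] give [H1 = adjoint T1]
    ([reduced_relation_adjoint]): an element of the adjoint is in
    [adjoint A0 = A0], hence has a boundary value [(0, h')], and [h'] must be
    orthogonal to [G1]. So [H1] is closed; it is symmetric as a part of [A0],
    and its defect numbers are equal because the Cayley transform of [A0] is a
    unitary map between its defect subspaces
    ([selfadjoint_extension_equal_defect]). The maximality of [Gamma1] is proved
    by the same two steps: after subtraction of an element of [Gamma] with the
    right boundary value, the candidate is in [adjoint A0 = A0], and Green's
    identity determines the rest ([reduced_maximal]).

    For the density of [T1] in [adjoint H1] ([dom_dense]) it suffices, again
    modulo [A0], to approximate an eigenvector of [adjoint H1] by eigenvectors
    of [T1]. This is a statement about vectors of [H], so that the projection
    theorem is needed only in [H] and not in the graph space [H * H].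

    The Hilbert space theory behind this is the projection theorem
    ([exists_projection]), the existence of orthonormal bases
    ([exists_maximal_orthonormal]) and a gliding hump argument for the
    Hellinger-Toeplitz theorem ([adjointable_bounded]). *)

(** * Inner products and approximation *)

Lemma exprVn2_gt0 (R : numFieldType) n : 0 < 2 ^- n :> R.
Proof. by rewrite invr_gt0 exprn_gt0. Qed.

Lemma exprVn2_ge0 (R : numFieldType) n : 0 <= 2 ^- n :> R.
Proof. exact/ltW/exprVn2_gt0. Qed.

Lemma exists_exprVn2_lt {R : realType} {e : R[i]} :
  0 < e -> exists n, 2 ^- n < e.
Proof.
move=> e0; have er : e = (complex.Re e)%:C%C by rewrite RRe_real ?gtr0_real.
move: e0; rewrite er ltcR => e0.
exists (Num.truncn (complex.Re e)^-1).
rewrite -[2 in X in X < _](rmorph_nat (real_complex R)) -rmorphXn -fmorphV ltcR.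
rewrite invf_plt ?posrE ?exprn_gt0//.
apply: (lt_le_trans (truncnS_gt _)).
by rewrite -natrX ler_nat ltn_expl.
Qed.

Lemma le_exprVn2_eq0 (R : realType) (a b : R[i]) :
  0 <= a -> (forall n, a <= b * 2 ^- n) -> a = 0.
Proof.
rewrite le_eqVlt => /orP[/eqP <-//|a0] ab.
have b0 : 0 < b.
  by apply: (lt_le_trans a0); have := ab 0%N; rewrite expr0 invr1 mulr1.
have [n] := exists_exprVn2_lt (divr_gt0 a0 b0).
rewrite ltr_pdivlMr// mulrC => /(le_lt_trans (ab n)).
by rewrite ltxx.
Qed.

Section InnerProduct.
Context {R : realType} {V : hilbertType R}.
Implicit Types x y z : V.

Lemma innerC x y : inner x y = (inner y x)^*.
Proof. by rewrite hermC expr0 mul1r. Qed.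

Lemma innerDl x y z : inner (x + y) z = inner x z + inner y z.
Proof. exact: linearDl. Qed.
Lemma innerDr x y z : inner z (x + y) = inner z x + inner z y.
Proof. exact: linearDr. Qed.
Lemma innerBl x y z : inner (x - y) z = inner x z - inner y z.
Proof. exact: linearBl. Qed.
Lemma innerBr x y z : inner z (x - y) = inner z x - inner z y.
Proof. exact: linearBr. Qed.
Lemma innerNl x z : inner (- x) z = - inner x z.
Proof. exact: linearNl. Qed.
Lemma innerNr x z : inner z (- x) = - inner z x.
Proof. exact: linearNr. Qed.
Lemma innerZl a x z : inner (a *: x) z = a * inner x z.
Proof. exact: linearZl_LR. Qed.
Lemma innerZr a x z : inner z (a *: x) = a^* * inner z x.
Proof. exact: linearZr_LR. Qed.
Lemma inner0l z : inner 0 z = 0.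
Proof. exact: linear0l. Qed.
Lemma inner0r z : inner z 0 = 0.
Proof. exact: linear0r. Qed.

Definition innerE := (innerDl, innerDr, innerNl, innerNr, innerZl, innerZr,
  inner0l, inner0r).

Lemma inner_sym0 {x y} : inner x y = 0 -> inner y x = 0.
Proof. by rewrite innerC => /eqP; rewrite conjC_eq0 => /eqP. Qed.

Lemma inner_self_eq0 x : inner x x = 0 -> x = 0.
Proof.
by rewrite inner_norm => /eqP; rewrite expf_eq0/= normr_eq0 => /eqP.
Qed.

Lemma parallelogram x y :
  `|x + y| ^+ 2 + `|x - y| ^+ 2 = 2 * `|x| ^+ 2 + 2 * `|y| ^+ 2.
Proof. rewrite -!inner_norm !innerE; ring. Qed.

(** The distance from [x] to the line through [y] is attained at
    [(inner x y / `|y| ^+ 2) *: y]; this is the only computation behind both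
    the Cauchy-Schwarz inequality and the orthogonality of near-minimisers. *)
Lemma dist_line x y : y != 0 ->
  `|x - (inner x y / `|y| ^+ 2) *: y| ^+ 2 =
  `|x| ^+ 2 - `|inner x y| ^+ 2 / `|y| ^+ 2.
Proof.
move=> y0; have ny : `|y| ^+ 2 != 0 by rewrite expf_neq0 ?normr_eq0.
rewrite [`|inner x y| ^+ 2]normCK -!inner_norm !innerE rmorphM fmorphV/=.
rewrite -(innerC y x) [(inner y y)^*]geC0_conj; last first.
  by rewrite inner_norm exprn_ge0.
rewrite -inner_norm in ny; field; exact: ny.
Qed.

Lemma cauchy_schwarz x y : `|inner x y| <= `|x| * `|y|.
Proof.
have [->|y0] := eqVneq y 0; first by rewrite inner0r normr0 mulr_ge0.
rewrite -(@ler_pXn2r _ 2)// ?nnegrE ?mulr_ge0// exprMn.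
rewrite -ler_pdivrMr ?exprn_gt0 ?normr_gt0// -subr_ge0 -dist_line//.
Qed.

(** Apart from uniqueness statements, this serves to reduce an identity between
    linear combinations of vectors to a ring identity. *)
Lemma eq_inner x y : (forall z, inner x z = inner y z) -> x = y.
Proof.
by move=> xy; apply/subr0_eq/inner_self_eq0; rewrite innerBl xy subrr.
Qed.

End InnerProduct.

Section Subspaces.
Context {K : pzRingType} {V : lmodType K} {L : set V}.
Hypothesis linL : linear_subspace L.

Lemma linear_subspace0 : L 0. Proof. by case: linL. Qed.
Lemma linear_subspaceP a {x y} : L x -> L y -> L (a *: x + y).
Proof. by case: linL => _; apply. Qed.
Lemma linear_subspaceD {x y} : L x -> L y -> L (x + y).
Proof. by move=> Lx; rewrite -[x]scale1r; exact: linear_subspaceP. Qed.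
Lemma linear_subspaceZ a x : L x -> L (a *: x).
Proof.
by move=> Lx; rewrite -[_ *: _]addr0; apply: linear_subspaceP linear_subspace0.
Qed.
Lemma linear_subspaceB {x y} : L x -> L y -> L (x - y).
Proof.
move=> Lx Ly; apply: linear_subspaceD => //.
by rewrite -scaleN1r; exact: linear_subspaceZ.
Qed.

End Subspaces.

Section Approximation.
Context {K : numFieldType} {V : normedModType K}.

Lemma closureP (A : set V) x :
  closure A x <-> forall e, 0 < e -> exists2 y, A y & `|x - y| < e.
Proof.
split=> [Ax e e0|Ax B /nbhs_ballP[e /= e0 eB]].
  have [y [Ay]] := Ax _ (nbhsx_ballx x e e0).
  by rewrite -ball_normE /= => xy; exists y.
have [y Ay xy] := Ax e e0; exists y; split=> //; apply: eB.
by rewrite -ball_normE.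
Qed.

Lemma closure_linear_subspace {A : set V} :
  linear_subspace A -> linear_subspace (closure A).
Proof.
move=> linA; split; first exact/subset_closure/linear_subspace0.
move=> a x y /closureP Ax /closureP Ay; apply/closureP => e e0.
have a0 : 0 < `|a| + 1 by rewrite ltr_wpDl.
have e1 : 0 < e / 2 / (`|a| + 1) by rewrite !divr_gt0.
have e2 : 0 < e / 2 by rewrite divr_gt0.
have [x' Ax' xx'] := Ax _ e1; have [y' Ay' yy'] := Ay _ e2.
exists (a *: x' + y'); first exact: linear_subspaceP.
rewrite opprD addrACA -scalerBr (le_lt_trans (ler_normD _ _))// (splitr e).
rewrite ler_ltD// normrZ.
apply: (@le_trans _ _ ((`|a| + 1) * (e / 2 / (`|a| + 1)))).
  by apply: ler_pM => //; [rewrite lerDl|exact: ltW].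
by rewrite mulrC divfK// gt_eqF.
Qed.

End Approximation.

Section Product.
Context {K : numFieldType} {U V : normedModType K}.

Lemma closure_prodP (A : set (U * V)) x y :
  closure A (x, y) <->
  forall e, 0 < e -> exists p, [/\ A p, `|x - p.1| < e & `|y - p.2| < e].
Proof.
split=> [Ax e e0|Ax B].
  have [p [Ap]] := Ax _ (nbhsx_ballx (x, y) e e0).
  by case; rewrite -!ball_normE /= => xp yp; exists p.
move=> /(@nbhs_ballP _ (U * V)%type)[e /= e0 eB].
have [p [Ap xp yp]] := Ax e e0; exists p; split=> //; apply: eB.
by split; rewrite -ball_normE.
Qed.

End Product.

Section Limits.
Context {R : realType} {V : completeNormedModType R[i]}.

(** With an explicit rate, the later passages to a limit become comparisons with
    a null sequence. *)
Lemma cauchy_rate (u : nat -> V) (r : nat -> R[i]) :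
  (forall n m, (n <= m)%N -> `|u m - u n| <= r n) ->
  (forall e, 0 < e -> exists n, r n < e) ->
  exists l, forall n, `|l - u n| <= r n.
Proof.
move=> ur r0.
have /cauchy_cvgP/cvg_ex[l ul] : cauchy (u @ \oo).
  apply/cauchy_exP => e e0; have [n rn] := r0 e e0.
  exists (u n); rewrite -ball_normE; exists n => // m /= nm.
  by rewrite distrC (le_lt_trans (ur _ _ nm)).
exists l => n; apply/ler_addgt0Pr => e e0.
move/cvg_ballP : ul => /(_ e e0)[N _ Nu].
have := Nu (maxn N n) (leq_maxl _ _); rewrite -ball_normE /= => lu.
rewrite -(subrKA (u (maxn N n))) (le_trans (ler_normD _ _))// [leRHS]addrC.
by apply: lerD; [exact: ltW|exact: ur (leq_maxr _ _)].
Qed.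

Lemma cauchy_rate_exprVn2 (u : nat -> V) (c : R[i]) : 0 <= c ->
  (forall n m, (n <= m)%N -> `|u m - u n| <= c * 2 ^- n) ->
  exists l, forall n, `|l - u n| <= c * 2 ^- n.
Proof.
rewrite le_eqVlt => /orP[/eqP <- uc|c0 /cauchy_rate].
  exists (u 0%N) => n; have := uc 0%N n (leq0n n).
  by rewrite !mul0r distrC.
apply=> e e0; have [n ne] := exists_exprVn2_lt (divr_gt0 e0 c0).
by exists n; rewrite -ltr_pdivlMl// mulrC.
Qed.

End Limits.

(** * Orthogonal projections and orthonormal bases *)

Section Projection.
Context {R : realType} {V : hilbertType R}.
Implicit Types (x y z : V) (L : set V).

(** The norm takes its values in [R[i]], whose order is partial, so the infimum
    is taken over the real parts. *)
Lemma exists_near_minimiser L x : L !=set0 ->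
  exists2 d : R[i], (forall y, L y -> d <= `|x - y| ^+ 2) &
    forall e, 0 < e -> exists2 y, L y & `|x - y| ^+ 2 < d + e.
Proof.
move=> [y0 Ly0]; pose N y : R := complex.Re (`|x - y| ^+ 2).
have NE y : (N y)%:C%C = `|x - y| ^+ 2 by rewrite RRe_real ?realX ?normr_real.
have infN : has_inf (N @` L).
  split; first by exists (N y0), y0.
  by exists 0 => _ [y _ <-]; rewrite -lecR NE exprn_ge0.
exists (inf (N @` L))%:C%C => [y Ly|e e0].
  by rewrite -NE lecR; apply: ge_inf infN.2 _ _; exists y.
have eE : (complex.Re e)%:C%C = e by rewrite RRe_real ?gtr0_real.
move: e0; rewrite -eE ltcR => e0.
have [_ [y Ly <-] ye] := inf_adherent e0 infN.
by exists y => //; rewrite -NE -rmorphD ltcR.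
Qed.

(** A minimising sequence for the distance to [L] is Cauchy by the
    parallelogram law, and its terms are nearly orthogonal to [L], because
    they cannot be improved much along any line of [L]. *)
Lemma exists_projection L x : linear_subspace L -> closed L ->
  exists2 y, L y & forall z, L z -> inner (x - y) z = 0.
Proof.
move=> linL cL.
have [d dL Ld] : exists2 d : R[i], (forall y, L y -> d <= `|x - y| ^+ 2) &
    forall e, 0 < e -> exists2 y, L y & `|x - y| ^+ 2 < d + e.
  by apply: exists_near_minimiser; exists 0; exact: linear_subspace0.
pose e n : R[i] := (2 ^- n / 2) ^+ 2.
have e0 n : 0 < e n by rewrite exprn_gt0// divr_gt0// exprVn2_gt0.
have /choice[u uP] : forall n, exists y, L y /\ `|x - y| ^+ 2 < d + e n.
  by move=> n; have [y ? ?] := Ld _ (e0 n); exists y.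
have Lu n : L (u n) := (uP n).1.
(* The midpoint of [u n] and [u m] is in [L], hence not closer to [x] than the
   infimum; [e] is chosen such that the parallelogram law gives this rate. *)
have cauchy_u n m : (n <= m)%N -> `|u m - u n| <= 1 * 2 ^- n.
  move=> nm; have emn : e m <= e n.
    rewrite ler_pXn2r ?nnegrE ?divr_ge0 ?exprVn2_ge0//.
    by rewrite ler_pM2r// lef_pV2 ?posrE ?exprn_gt0// ler_weXn2l// ler1n.
  have Lmid : L (2^-1 *: (u n + u m)).
    exact/linear_subspaceZ/linear_subspaceD.
  have := parallelogram (x - u n) (x - u m).
  have -> : x - u n + (x - u m) = 2 *: (x - 2^-1 *: (u n + u m)).
    rewrite scalerBr scalerA mulfV// scale1r addrACA -opprD.
    by rewrite scaler_nat mulr2n.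
  have -> : x - u n - (x - u m) = u m - u n by rewrite opprB addrC subrKA.
  rewrite normrZ exprMn ger0_norm// => /(canRL (addKr _)) E.
  rewrite mul1r -(@ler_pXn2r _ 2) ?nnegrE ?exprVn2_ge0// E.
  have -> : (2 ^- n) ^+ 2 = - (2 ^+ 2 * d) + (2 * (d + e n) + 2 * (d + e n)).
    by rewrite /e; field.
  rewrite lerD// ?lerN2 ?ler_pM2l ?exprn_gt0 ?dL//.
  rewrite lerD// ler_pM2l//; first exact: ltW (uP n).2.
  by rewrite (le_trans (ltW (uP m).2))// lerD2l.
have [p pu] := cauchy_rate_exprVn2 u 1 ler01 cauchy_u.
exists p => [|z Lz].
  have -> : L = closure L by apply/closure_id.
  apply/closureP => c /exists_exprVn2_lt[n nc]; exists (u n) => //.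
  by rewrite (le_lt_trans (pu n))// mul1r.
have [->|z0] := eqVneq z 0; first by rewrite inner0r.
have nz : 0 < `|z| by rewrite normr_gt0.
apply/eqP; rewrite -normr_eq0; apply/eqP.
apply: (@le_exprVn2_eq0 _ _ (2 * `|z|)) => // n.
rewrite -(subrKA (u n)) innerDl (le_trans (ler_normD _ _))//.
rewrite -mulrA mulr_natl mulr2n lerD//; last first.
  rewrite (le_trans (cauchy_schwarz _ _))// mulrC ler_pM2l// distrC.
  by rewrite -[leRHS]mul1r.
(* Moving [u n] along [z] gains at most [e n]. *)
have : d <= `|x - (u n + (inner (x - u n) z / `|z| ^+ 2) *: z)| ^+ 2.
  by apply: dL; apply: linear_subspaceD => //; exact: linear_subspaceZ.
rewrite opprD addrA dist_line// lerBrDr => /le_lt_trans/(_ (uP n).2).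
rewrite ltrD2l ltr_pdivrMr ?exprn_gt0// -exprMn.
rewrite ltr_pXn2r ?nnegrE ?mulr_ge0 ?divr_ge0 ?exprVn2_ge0//.
move=> /ltW /le_trans; apply; rewrite mulrC ler_pM2l// ler_pdivrMr//.
by rewrite ler_peMr ?ler1n// exprVn2_ge0.
Qed.

(** The nontrivial half of the bipolar theorem. *)
Lemma closure_of_orthogonal L x : linear_subspace L ->
  (forall g, (forall z, L z -> inner z g = 0) -> inner x g = 0) ->
  closure L x.
Proof.
move=> linL xL.
have [p Lp xp] := exists_projection _ x (closure_linear_subspace linL)
  (@closed_closure _ L).
have Lxp z : L z -> inner z (x - p) = 0.
  by move=> Lz; apply/inner_sym0/xp/subset_closure.
suff -> : x = p by [].
apply/subr0_eq/inner_self_eq0; rewrite innerBl xL//.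
by rewrite (inner_sym0 (xp _ Lp)) subrr.
Qed.

(** By Zorn's lemma there is a maximal orthonormal subset of [N]; a nonzero
    vector of [N] orthogonal to it could be normalised and added. *)
Lemma exists_maximal_orthonormal (N : set V) : linear_subspace N ->
  exists B, [/\ B `<=` N, forall x, B x -> inner x x = 1,
    forall x y, B x -> B y -> x <> y -> inner x y = 0 &
    forall x, N x -> (forall y, B y -> inner x y = 0) -> x = 0].
Proof.
move=> linN.
pose P := [set B : set V | [/\ B `<=` N, forall x, B x -> inner x x = 1 &
  forall x y, B x -> B y -> x <> y -> inner x y = 0]].
have [F FP totF|B [[BN B1 B0] Bmax]] := @Zorn_bigcup V P.
  split=> [x [X FX Xx]|x [X FX Xx]|x y [X FX Xx] [Y FY Yy]].
  - by case: (FP _ FX) => XN _ _; exact: XN.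
  - by case: (FP _ FX) => _ X1 _; exact: X1.
  - have [XY|YX] := totF _ _ FX FY.
    + by case: (FP _ FY) => _ _; apply => //; exact: XY.
    + by case: (FP _ FX) => _ _; apply => //; exact: YX.
exists B; split=> // x Nx xB; apply: contrapT => /eqP x0.
have nx : `|x| != 0 by rewrite normr_eq0.
pose e := `|x|^-1 *: x.
have e1 : inner e e = 1.
  rewrite !innerE inner_norm geC0_conj ?invr_ge0//; field; exact: nx.
have eB y : B y -> inner e y = 0 by move=> By; rewrite innerZl xB// mulr0.
apply: (Bmax (B `|` [set e])); last split.
- split; first exact: subsetUl.
  by move=> /(_ e (or_intror erefl))/eB/eqP; rewrite e1 oner_eq0.
- by move=> _ [/BN //|->]; exact: linear_subspaceZ.
- by move=> _ [/B1 //|->].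
- move=> y z [By|->] [Bz|->] yz; [exact: B0|exact/inner_sym0/eB|exact: eB|].
  by case: yz.
Qed.

Lemma smallest_linear_subspace (B : set V) :
  linear_subspace (smallest (@linear_subspace _ V) B).
Proof.
split=> [C [linC _]|a x y Bx By C [linC BC]]; first exact: linear_subspace0.
by apply: linear_subspaceP => //; [apply: Bx|apply: By].
Qed.

(** A vector of [N] minus its projection onto the closed span of [B] is still in
    [N] and orthogonal to [B], hence zero. *)
Lemma maximal_orthonormal_basis (N B : set V) : linear_subspace N -> closed N ->
  B `<=` N -> (forall x, B x -> inner x x = 1) ->
  (forall x y, B x -> B y -> x <> y -> inner x y = 0) ->
  (forall x, N x -> (forall y, B y -> inner x y = 0) -> x = 0) ->
  orthonormal_basis N B.
Proof.
move=> linN cN BN B1 B0 Bmax; split=> // x Nx.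
pose L := smallest (@linear_subspace _ V) B.
have [p Lp xp] := exists_projection (closure L) x
  (closure_linear_subspace (smallest_linear_subspace B)) (@closed_closure _ L).
suff -> : x = p by [].
apply/subr0_eq/Bmax => [|y By]; last first.
  by apply/xp/subset_closure => C [_]; exact.
apply: linear_subspaceB => //.
have -> : N = closure N by apply/closure_id.
by apply: closureS Lp; exact: smallest_sub.
Qed.

(** The image of a maximal orthonormal set is maximal, because a vector [U x]
    orthogonal to the image of [B] comes from a vector [x] orthogonal to [B]. *)
Lemma eq_dimension_isometry (N N' : set V) (U : V -> V) :
  linear_subspace N -> closed N -> linear_subspace N' -> closed N' ->
  (forall x y, inner (U x) (U y) = inner x y) -> U @` N = N' ->
  eq_dimension N N'.
Proof.
move=> linN cN linN' cN' UU UN.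
have [B [BN B1 B0 Bmax]] := exists_maximal_orthonormal _ linN.
exists B, (U @` B); split.
- exact: maximal_orthonormal_basis.
- apply: maximal_orthonormal_basis => //.
  + by rewrite -UN; exact: image_subset.
  + by move=> _ [x Bx <-]; rewrite UU B1.
  + move=> _ _ [x Bx <-] [y By <-] xy; rewrite UU B0//.
    by move=> /(congr1 U).
  + rewrite -UN => _ [x Nx <-] xB; apply: inner_self_eq0.
    rewrite UU (Bmax x)// ?inner0l// => y By.
    by rewrite -(UU x y) xB//; exists y.
- apply: card_esym; apply: inj_card_eq => x y _ _ xy.
  by apply: eq_inner => z; rewrite -UU xy UU.
Qed.

End Projection.

(** * The Hellinger-Toeplitz theorem *)

Section UniformBoundedness.
Context {R : realType} {U V : hilbertType R}.

(** The vector is the sum of a series with terms of length [4 ^- n]: at stage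
    [n] the sign of the term along [v n] is chosen such that it does not cancel
    against the previous terms, and the later terms are too short to undo it. *)
Lemma gliding_hump (v : nat -> V) : (forall n, v n != 0) ->
  exists y, forall n, 4 ^- n * `|v n| <= 2 * `|inner y (v n)|.
Proof.
move=> v0; have nv n : `|v n| != 0 by rewrite normr_eq0.
pose w n : V := (4 ^- n / `|v n|) *: v n.
have nw n : `|w n| = 4 ^- n.
  rewrite normrZ ger0_norm ?divr_ge0 ?invr_ge0 ?exprn_ge0//.
  by rewrite divfK.
have wv n : inner (w n) (v n) = 4 ^- n * `|v n|.
  by rewrite innerZl inner_norm expr2 mulrA divfK.
pose step n (y : V) : V :=
  if `|inner (w n) (v n)| <= `|inner (y + w n) (v n)| then y + w n else y - w n.
have step_norm n y : `|step n y - y| = 4 ^- n.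
  by rewrite /step; case: ifP => _; rewrite addrC addKr ?normrN nw.
have step_inner n y : 4 ^- n * `|v n| <= `|inner (step n y) (v n)|.
  have <- : `|inner (w n) (v n)| = 4 ^- n * `|v n|.
    by rewrite wv ger0_norm// mulr_ge0// invr_ge0 exprn_ge0.
  rewrite /step; case: ifP => // /negbT.
  rewrite -real_ltNge ?normr_real// => lt_w.
  apply: contraT; rewrite -real_ltNge ?normr_real// => lt_w'.
  have := ltrD lt_w lt_w'; rewrite -mulr2n -normrMn.
  have -> : inner (w n) (v n) *+ 2 =
      inner (y + w n) (v n) - inner (y - w n) (v n).
    by rewrite -innerBl opprB addrC subrKA innerDl -mulr2n.
  by move=> /(le_lt_trans (ler_normB _ _)); rewrite ltxx.
pose u := nat_rect (fun=> V) 0 step.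
have u_step n : `|u n.+1 - u n| = 4 ^- n by exact: step_norm.
(* The sum of the [4 ^- k] for [k >= n]. *)
pose r n : R[i] := 4 / 3 * 4 ^- n.
have u_dist n k : `|u (n + k)%N - u n| <= r n - r (n + k)%N.
  elim: k => [|k IHk]; first by rewrite addn0 !subrr normr0.
  rewrite -(subrKA (u (n + k)%N)) (le_trans (ler_normD _ _))// addnS u_step.
  apply: (le_trans (lerD (lexx _) IHk)); rewrite /r exprSr.
  have : 4 ^+ (n + k) != 0 :> R[i] by rewrite expf_neq0.
  move: (4 ^+ (n + k)) (4 ^- n) => a b a0.
  by rewrite le_eqVlt; apply/orP; left; apply/eqP; field.
have r_ge0 n : 0 <= r n by rewrite mulr_ge0 ?divr_ge0 ?invr_ge0 ?exprn_ge0.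
have [n m nm|e e0|y uy] := @cauchy_rate _ _ u r.
- by rewrite -(subnKC nm) (le_trans (u_dist _ _))// gerBl.
- have [n ne] := exists_exprVn2_lt (divr_gt0 e0 (ltr0Sn _ 1)).
  exists n; move: ne; rewrite ltr_pdivlMr// mulrC; apply: le_lt_trans.
  apply: ler_pM; rewrite ?divr_ge0 ?invr_ge0 ?exprn_ge0//.
    by rewrite ler_pdivrMr// -natrM ler_nat.
  by rewrite lef_pV2 ?posrE ?exprn_gt0// lerXn2r ?nnegrE// ler_nat.
exists y => n.
(* The terms after the one along [v n] lose at most a third of what it gives. *)
have err : `|inner (y - u n.+1) (v n)| <= 3^-1 * (4 ^- n * `|v n|).
  rewrite (le_trans (cauchy_schwarz _ _))// mulrA ler_pM2r ?normr_gt0//.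
  apply: (le_trans (uy _)); rewrite /r exprS.
  have : 4 ^+ n != 0 :> R[i] by rewrite expf_neq0.
  move: (4 ^+ n) => a a0.
  by rewrite le_eqVlt; apply/orP; left; apply/eqP; field.
have un : `|inner (u n.+1) (v n)| <=
    `|inner y (v n)| + `|inner (y - u n.+1) (v n)|.
  by rewrite -{1}(subKr y (u n.+1)) innerBl ler_normB.
have := le_trans (step_inner n (u n)) (le_trans un (lerD (lexx _) err)).
have : 0 <= 4 ^- n * `|v n| by rewrite mulr_ge0// invr_ge0 exprn_ge0.
move: (4 ^- n * _) => a a0; rewrite -lerBlDr => ya.
apply: le_trans (ler_wpM2l (ler0n _ 2) ya).
have -> : 2 * (a - 3^-1 * a) = a + 3^-1 * a by field.
by rewrite lerDl mulr_ge0.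
Qed.

(** A form of the Hellinger-Toeplitz theorem. If [A] is unbounded, choose [x n]
    with [8 ^+ n * `|x n| < `|A (x n)|] and [y] by the gliding hump for the
    [A (x n)]. Then [inner (A (x n)) y = inner (x n) (B y)] is bounded by
    [`|x n| * `|B y|], which forces [2 ^+ n <= 2 * `|B y|] for all [n]. *)
Lemma adjointable_bounded (A : U -> V) (B : V -> U) :
  (forall x y, inner (A x) y = inner x (B y)) -> bounded_operator A.
Proof.
move=> AB; split=> [a x y|].
  by apply: eq_inner => z; rewrite !(AB, innerE).
apply: contrapT => unbdd.
have /choice[x xP] : forall n, exists x, 8 ^+ n * `|x| < `|A x|.
  move=> n; apply: contrapT => bdd; apply: unbdd; exists (8 ^+ n) => x.
  rewrite real_leNgt ?normr_real ?realM ?realX ?normr_real//.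
  by apply/negP => ltx; apply: bdd; exists x.
have x_gt0 n : 0 < `|A (x n)|.
  by rewrite (le_lt_trans _ (xP n))// mulr_ge0// exprn_ge0.
have [n|y yP] := gliding_hump (A \o x); first by rewrite /= -normr_gt0.
suff /eqP : 1 = 0 :> R[i] by rewrite oner_eq0.
apply: (@le_exprVn2_eq0 _ _ (2 * `|B y|)) => // n.
have x0 : 0 < `|x n|.
  rewrite normr_gt0; apply/eqP => xn0; have := xP n.
  have -> : A (x n) = 0 by apply: eq_inner => z; rewrite AB xn0 !inner0l.
  by rewrite xn0 !normr0 mulr0 ltxx.
have := yP n; rewrite /= -[inner y _]conjCK -innerC AB norm_conjC.
move=> By; have Pn : 0 < 4 ^+ n :> R[i] by rewrite exprn_gt0.
have {}By : `|A (x n)| <= 4 ^+ n * (2 * `|inner (x n) (B y)|).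
  by rewrite mulrC -ler_pdivrMr// mulrC.
have := lt_le_trans (xP n) By.
move=> /lt_le_trans/(_ (ler_wpM2l (ltW Pn) (ler_wpM2l _ (cauchy_schwarz _ _)))).
rewrite [`|x n| * _]mulrC !mulrA ltr_pM2r// => /(_ (ler0n _ 2))/ltW.
have -> : 8 ^+ n = 4 ^+ n * 2 ^+ n :> R[i] by rewrite -exprMn -natrM.
rewrite -[_ * 2 * _]mulrA ler_pM2l// => By2.
by rewrite ler_pdivlMr ?exprn_gt0// mul1r.
Qed.

End UniformBoundedness.

(** * Adjoint and selfadjoint relations *)

Section Adjoints.
Context {R : realType} {H : hilbertType R}.
Implicit Types (T A : set (H * H)) (l : R[i]).

Lemma adjoint_linear T : linear_subspace (adjoint T).
Proof.
split=> [f _|a x y xT yT f Tf] /=; first by rewrite !inner0r.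
by rewrite !innerE xT// yT.
Qed.

Lemma adjoint_closed T : closed (adjoint T).
Proof.
move=> -[x y] /closure_prodP xy f Tf /=.
apply/eqP; rewrite -subr_eq0 -normr_eq0; apply/eqP.
apply: (@le_exprVn2_eq0 _ _ (`|f.2| + `|f.1|)) => // n.
have [p [pT xp yp]] := xy _ (exprVn2_gt0 _ n).
have -> : inner f.2 x - inner f.1 y = inner f.2 (x - p.1) - inner f.1 (y - p.2).
  rewrite !innerBr (pT _ Tf); ring.
rewrite (le_trans (ler_normB _ _))// mulrDl lerD//;
  by rewrite (le_trans (cauchy_schwarz _ _))// ler_wpM2l// ltW.
Qed.

Lemma eigen_linear T l : linear_subspace T ->
  linear_subspace [set x | T (x, l *: x)].
Proof.
move=> linT; split=> [|a x y Tx Ty] /=.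
  by rewrite scaler0; exact: linear_subspace0 linT.
have -> : (a *: x + y, l *: (a *: x + y)) = a *: (x, l *: x) + (y, l *: y).
  by congr pair; rewrite /= scalerDr !scalerA mulrC.
exact: (linear_subspaceP linT).
Qed.

Lemma defect_linear T l : linear_subspace (defect_subspace T l).
Proof. exact/eigen_linear/adjoint_linear. Qed.

Lemma defect_closed T l : closed (defect_subspace T l).
Proof.
move=> x /closureP Tx.
suff : closure (adjoint T) (x, l *: x) by move/adjoint_closed.
apply/closure_prodP => e e0.
have l0 : 0 < `|l| + 1 by rewrite ltr_wpDl.
have [y Ty xy] := Tx _ (divr_gt0 e0 l0); exists (y, l *: y).
move: xy; rewrite ltr_pdivlMr// => xy; split=> //=.
  by rewrite (le_lt_trans _ xy)// ler_peMr// lerDr.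
rewrite -scalerBr normrZ (le_lt_trans _ xy)// mulrC ler_wpM2l//.
by rewrite lerDl.
Qed.

Lemma nonreal_conj {l} : l \isn't Num.real -> l^* \isn't Num.real.
Proof. by rewrite !CrealE conjCK eq_sym. Qed.

Lemma nonreal_i : 'i \isn't @Num.real R[i].
Proof.
rewrite CrealE conjCi eq_sym -subr_eq0 opprK -mulr2n mulrn_eq0 /=.
exact: neq0Ci.
Qed.

(** By symmetry, the imaginary part of [inner (f' - l *: f) f] does not involve
    [f']. *)
Lemma symmetric_lower_bound {A} l {f f'} : symmetric_relation A -> A (f, f') ->
  `|l^* - l| * `|f| <= 2 * `|f' - l *: f|.
Proof.
move=> symA Af; have [->|f0] := eqVneq f 0.
  by rewrite normr0 mulr0 mulr_ge0.
rewrite -(@ler_pM2r _ `|f|) ?normr_gt0//.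
have -> : `|l^* - l| * `|f| * `|f| =
    `|inner (f' - l *: f) f - inner f (f' - l *: f)|.
  rewrite !innerE (symA _ Af (f, f') Af)/=.
  rewrite [X in _ = `|X|](_ : _ = (l^* - l) * inner f f); last by ring.
  by rewrite normrM inner_norm normrX normr_id mulrA.
rewrite (le_trans (ler_normB _ _))// -mulrA mulr_natl mulr2n lerD//.
  exact: cauchy_schwarz.
by rewrite mulrC cauchy_schwarz.
Qed.

(** The range of [A - l] is closed because [A] is closed and [A - l] is bounded
    below, and it is dense because a vector orthogonal to it is an eigenvector
    of [A] at the conjugate of [l]. *)
Lemma selfadjoint_range A l g : selfadjoint_relation A ->
  l \isn't Num.real -> exists f f', A (f, f') /\ f' - l *: f = g.
Proof.
move=> saA lNR.
have symA : symmetric_relation A by rewrite /symmetric_relation -saA.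
have linA : linear_subspace A by rewrite saA; exact: adjoint_linear.
have cA : A = closure A.
  by apply/closure_id; rewrite saA; exact: adjoint_closed.
pose d : R[i] := `|l^* - l|.
have d0 : 0 < d by rewrite normr_gt0 subr_eq0 -CrealE.
pose W : set H := [set p.2 - l *: p.1 | p in A].
have linW : linear_subspace W.
  split=> [|a _ _ [p Ap <-] [q Aq <-]].
    by exists 0; [exact: linear_subspace0|rewrite /= scaler0 subr0].
  exists (a *: p + q); first exact: linear_subspaceP.
  by rewrite /= scalerBr scalerDr opprD addrACA !scalerA [a * l]mulrC.
have /closureP Wg : closure W g.
  apply: closure_of_orthogonal => // h Wh.
  suff -> : h = 0 by rewrite inner0r.
  have : A (h, l^* *: h).
    rewrite saA => p Ap; apply/eqP; rewrite /= innerE conjCK -subr_eq0.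
    by rewrite -innerZl -innerBl Wh//; exists p.
  move=> /(symmetric_lower_bound l^* symA).
  rewrite subrr normr0 mulr0 conjCK pmulr_rle0; last by rewrite distrC.
  by rewrite normr_le0 => /eqP.
have /choice[p pP] : forall n, exists p, A p /\
    `|g - (p.2 - l *: p.1)| < 2 ^- n.
  by move=> n; have [_ [p Ap <-] gp] := Wg _ (exprVn2_gt0 _ n); exists p.
pose c := 4 / d.
have c0 : 0 <= c by rewrite divr_ge0// ltW.
have [n m nm|f fp] := @cauchy_rate_exprVn2 _ _ (fun n => (p n).1) c c0.
  have Apq : A ((p m).1 - (p n).1, (p m).2 - (p n).2).
    exact: (linear_subspaceB linA (pP m).1 (pP n).1).
  have := symmetric_lower_bound l symA Apq.
  rewrite -/d mulrC -ler_pdivlMr// => /le_trans; apply.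
  rewrite /c [_ / d * _]mulrAC ler_pM2r ?invr_gt0//.
  rewrite -[4]/((2 * 2)%:R) natrM -mulrA ler_pM2l//.
  have -> : (p m).2 - (p n).2 - l *: ((p m).1 - (p n).1) =
      (g - ((p n).2 - l *: (p n).1)) - (g - ((p m).2 - l *: (p m).1)).
    by apply: eq_inner => z; rewrite !innerE; ring.
  rewrite (le_trans (ler_normB _ _))// mulr_natl mulr2n lerD//.
    exact: ltW (pP n).2.
  rewrite (le_trans (ltW (pP m).2))// lef_pV2 ?posrE ?exprn_gt0//.
  by rewrite ler_weXn2l// ler1n.
exists f, (g + l *: f); split; last by rewrite addrK.
rewrite cA; apply/closure_prodP => e e0.
pose k := 1 + (1 + `|l|) * c.
have k0 : 0 < k by rewrite ltr_pwDl// mulr_ge0// addr_ge0.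
have [n] := exists_exprVn2_lt (divr_gt0 e0 k0).
rewrite ltr_pdivlMr// mulrC => ne; exists (p n); split; first exact: (pP n).1.
  rewrite (le_lt_trans (fp n))// (le_lt_trans _ ne)// ler_pM2r ?exprVn2_gt0//.
  rewrite /k mulrDl mul1r addrCA lerDl addr_ge0// mulr_ge0//.
have -> : g + l *: f - (p n).2 =
    (g - ((p n).2 - l *: (p n).1)) + l *: (f - (p n).1).
  by apply: eq_inner => z; rewrite !innerE; ring.
rewrite (le_lt_trans _ ne)// (le_trans (ler_normD _ _))// normrZ /k mulrDl.
rewrite mul1r lerD//; first exact: ltW (pP n).2.
rewrite (le_trans (ler_wpM2l _ (fp n)))// mulrA ler_pM2r ?exprVn2_gt0//.
by rewrite ler_wpM2r// lerDr.
Qed.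

Lemma cayley_isometry {A p q} : symmetric_relation A -> A p -> A q ->
  inner (p.2 - 'i *: p.1) (q.2 - 'i *: q.1) =
  inner (p.2 + 'i *: p.1) (q.2 + 'i *: q.1).
Proof.
move=> symA Ap Aq; rewrite !innerE conjCi (symA _ Aq _ Ap); ring.
Qed.

Lemma adjoint_eigenP T l x :
  adjoint T (x, l *: x) <-> forall f, T f -> inner (f.2 - l^* *: f.1) x = 0.
Proof.
split=> Tx f Tf; first by rewrite !innerE (Tx _ Tf)/= innerZr subrr.
by apply/eqP; rewrite /= innerZr -subr_eq0 -innerZl -innerBl Tx.
Qed.

(** The Cayley transform of a selfadjoint extension [A] of [T] is a unitary
    operator which maps the defect subspace at ['i] onto the one at [- 'i]. *)
Lemma selfadjoint_extension_equal_defect T A :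
  T `<=` A -> selfadjoint_relation A -> equal_defect_numbers T.
Proof.
move=> TA saA.
have symA : symmetric_relation A by rewrite /symmetric_relation -saA.
have linA : linear_subspace A by rewrite saA; exact: adjoint_linear.
have Ni x : defect_subspace T 'i x <->
    forall f, T f -> inner (f.2 + 'i *: f.1) x = 0.
  split=> [/adjoint_eigenP h f /h|h]; first by rewrite conjCi scaleNr opprK.
  by apply/adjoint_eigenP => f /h; rewrite conjCi scaleNr opprK.
have NNi x : defect_subspace T (- 'i) x <->
    forall f, T f -> inner (f.2 - 'i *: f.1) x = 0.
  by have := adjoint_eigenP T (- 'i) x; rewrite rmorphN /= conjCi opprK.
have /choice[P PA] : forall x, exists p : H * H, A p /\ p.2 + 'i *: p.1 = x.
  move=> x; have [f [f' [Af fx]]] := selfadjoint_range A (- 'i) x saA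
    ltac:(by rewrite -conjCi; exact/nonreal_conj/nonreal_i).
  by exists (f, f'); rewrite scaleNr opprK in fx.
rewrite /equal_defect_numbers complexiE.
apply: (eq_dimension_isometry _ _ (fun x => (P x).2 - 'i *: (P x).1)).
- exact: defect_linear.
- exact: defect_closed.
- exact: defect_linear.
- exact: defect_closed.
- by move=> x y; rewrite (cayley_isometry symA (PA x).1 (PA y).1) !(PA _).2.
apply/seteqP; split=> [_ [x /Ni Nx <-]|y /NNi Ny].
  apply/NNi => f Tf; rewrite (cayley_isometry symA (TA _ Tf) (PA x).1).
  by rewrite (PA x).2 Nx.
have [f [f' [Aq qy]]] := selfadjoint_range A 'i y saA nonreal_i.
exists (f' + 'i *: f).
  apply/Ni => q Tq; have /= <- := cayley_isometry symA (TA _ Tq) Aq.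
  by rewrite qy Ny.
set x := f' + _; rewrite -qy.
have Ad : A ((P x).1 - f, (P x).2 - f').
  exact: (linear_subspaceB linA (PA x).1 Aq).
apply/subr0_eq/inner_self_eq0; have := cayley_isometry symA Ad Ad.
have -> : (P x).2 - 'i *: (P x).1 - (f' - 'i *: f) =
    (P x).2 - f' - 'i *: ((P x).1 - f).
  by apply: eq_inner => z; rewrite !innerE; ring.
move=> -> /=.
have -> : (P x).2 - f' + 'i *: ((P x).1 - f) = 0.
  have := (PA x).2; rewrite {2}/x => /(congr1 (fun z => z - x)).
  by rewrite subrr => <-; apply: eq_inner => z; rewrite !innerE; ring.
by rewrite inner0l.
Qed.

End Adjoints.

(** * The [gamma]-field and the Weyl function *)

Section WeylFunction.
Context {R : realType} {H G : hilbertType R} {Gamma : set ((H * H) * (G * G))}.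
Hypothesis linGamma : linear_relation Gamma.
Hypothesis GammaB : conditions_B Gamma.
Implicit Types (f g : H) (h k : G) (l : R[i]).

Local Notation A0 := (rel_ker (Gamma0 Gamma)).

Lemma greenP {f f' g g' h h' k k'} :
  Gamma ((f, f'), (h, h')) -> Gamma ((g, g'), (k, k')) ->
  inner f' g - inner f g' = inner h' k - inner h k'.
Proof. by case: GammaB => green _ _ p q; exact: (green _ _ p q). Qed.

Lemma Gamma0_surjective h : exists f f' h', Gamma ((f, f'), (h, h')).
Proof.
case: GammaB => _ ran _; have : rel_ran (Gamma0 Gamma) h by rewrite ran.
by move=> [[f f'] [h' fh]]; exists f, f', h'.
Qed.

Lemma ker_selfadjoint : selfadjoint_relation A0.
Proof. by case: GammaB. Qed.

Lemma ker_symmetric : symmetric_relation A0.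
Proof. by rewrite /symmetric_relation -ker_selfadjoint. Qed.

(** An element with boundary value [h] is corrected by an element of [A0], which
    has boundary value zero, to an eigenvector. *)
Lemma weyl_solution l h : l \isn't Num.real ->
  exists f h', Gamma ((f, l *: f), (h, h')).
Proof.
move=> lNR; have [e [e' [k eh]]] := Gamma0_surjective h.
have [f [f' [[k' fk'] fe]]] :=
  selfadjoint_range _ l (l *: e - e') ker_selfadjoint lNR.
exists (e + f), (k + k').
suff -> : ((e + f, l *: (e + f)), (h, k + k')) =
    ((e, e'), (h, k)) + ((f, f'), (0, k')) :> (H * H) * (G * G).
  exact: (linear_subspaceD linGamma eh fk').
congr (_, _); congr (_, _); rewrite /= ?addr0//.
by rewrite scalerDr -(subrK (l *: f) f') fe addrA addrCA subrr addr0.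
Qed.

Lemma weyl_unique {l f h h1 h2 g} : l \isn't Num.real ->
  Gamma ((f, l *: f), (h, h1)) -> Gamma ((g, l *: g), (h, h2)) ->
  f = g /\ h1 = h2.
Proof.
move=> lNR fh gh.
have d : Gamma ((f - g, l *: (f - g)), (0, h1 - h2)).
  suff -> : ((f - g, l *: (f - g)), (0, h1 - h2)) =
      ((f, l *: f), (h, h1)) - ((g, l *: g), (h, h2)) :> (H * H) * (G * G).
    exact: (linear_subspaceB linGamma fh gh).
  by congr (_, _); congr (_, _); rewrite /= ?scalerBr ?subrr.
have fg : f = g.
  apply/subr0_eq; have : A0 (f - g, l *: (f - g)) by exists (h1 - h2).
  move=> /(symmetric_lower_bound l ker_symmetric).
  rewrite subrr normr0 mulr0 pmulr_rle0 ?normr_gt0 ?subr_eq0 -?CrealE//.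
  by rewrite normr_le0 => /eqP.
split=> //; apply/subr0_eq/eq_inner => k; rewrite inner0l.
have [e [e' [k' ek]]] := Gamma0_surjective k.
have := greenP d ek.
by rewrite fg subrr scaler0 !inner0l !subr0.
Qed.

(** The [gamma]-field and the Weyl function are bounded because they have
    adjoints which are everywhere defined: by Green's identity, the adjoint of
    [M l] is [M l^*], and the one of [gamma l] maps [g] to [m] when
    [(e, e')] in [A0], with boundary value [(0, m)], solves
    [e' - l^* *: e = g]. *)
Lemma weyl_bounded l : l \isn't Num.real ->
  exists (gamma : G -> H) (M : G -> G),
    [/\ bounded_operator gamma, gamma_field Gamma l = graph gamma,
        bounded_operator M & weyl_family Gamma l = graph M].
Proof.
move=> lNR; have lNR' := nonreal_conj lNR.
have /choice[s sP] : forall h, exists s : H * G,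
    Gamma ((s.1, l *: s.1), (h, s.2)).
  by move=> h; have [f [h' fh]] := weyl_solution l h lNR; exists (f, h').
have /choice[t tP] : forall h, exists t : H * G,
    Gamma ((t.1, l^* *: t.1), (h, t.2)).
  by move=> h; have [f [h' fh]] := weyl_solution _ h lNR'; exists (f, h').
have /choice[r rP] : forall g, exists r : H * G,
    Gamma ((r.1, g + l^* *: r.1), (0, r.2)).
  move=> g; have [e [e' [[m em] <-]]] :=
    selfadjoint_range _ _ g ker_selfadjoint lNR'.
  by exists (e, m); rewrite subrK.
exists (fst \o s), (snd \o s); split=> /=.
- apply: (adjointable_bounded _ (snd \o r)) => h g /=.
  have := greenP (sP h) (rP g).
  rewrite !innerE conjCK opprD addrCA subrr addr0 sub0r.
  by move=> /oppr_inj.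
- apply/seteqP; split=> -[h f]; last first.
    by rewrite /graph /= => ->; exists (s h).2; exact: sP.
  by move=> [h' fh]; exact: (weyl_unique lNR fh (sP h)).1.
- apply: (adjointable_bounded _ (snd \o t)) => h k /=.
  have := greenP (sP h) (tP k).
  by rewrite !innerE conjCK subrr => /esym/eqP; rewrite subr_eq0 => /eqP.
- apply/seteqP; split=> -[h h']; last first.
    by rewrite /graph /= => ->; exists (s h).1; exact: sP.
  by move=> [f fh]; exact: (weyl_unique lNR fh (sP h)).2.
Qed.

End WeylFunction.

(** * Projections of an orthogonal decomposition *)

Section OrthogonalDecomposition.
Context {R : realType} {G : hilbertType R} {G1 G2 : closed_subspace G}.
Hypothesis G12 : orthogonal_decomposition G1 G2.

Lemma inner_val (K : closed_subspace G) (x y : K) :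
  inner x y = inner (\val x) (\val y).
Proof. by []. Qed.

Lemma projection_unique (K : closed_subspace G) (x : G) (y : K) :
  (forall z : K, inner (x - \val y) (\val z) = 0) ->
  orthogonal_projection K x = y.
Proof.
move=> xy.
pose P := [set y : K | forall z : K, inner (x - \val y) (\val z) = 0].
have : P (orthogonal_projection K x) by apply: (@xgetPex _ 0 P); exists y.
move=> xp; apply/val_inj/subr0_eq/inner_self_eq0.
set p := orthogonal_projection K x in xp *.
rewrite {2}(_ : \val p - \val y = \val (p - y)); last by rewrite raddfB.
by rewrite -(subrKA x) addrC -(opprB x) innerDl innerNl xp xy subr0.
Qed.

Lemma projection_decomposition (x1 : G1) (x2 : G2) :
  orthogonal_projection G1 (\val x1 + \val x2) = x1 /\
  orthogonal_projection G2 (\val x1 + \val x2) = x2.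
Proof.
have [G12o _] := G12.
split; apply: projection_unique => z.
  by rewrite addrC addKr; apply/inner_sym0/G12o.
by rewrite addrK G12o.
Qed.

Lemma projection1_inner (x : G) (z : G1) :
  inner (\val (orthogonal_projection G1 x)) (\val z) = inner x (\val z).
Proof.
have [G12o G12s] := G12; have [x1 [x2 ->]] := G12s x.
rewrite (projection_decomposition x1 x2).1 innerDl.
by rewrite (inner_sym0 (G12o z x2)) addr0.
Qed.

Lemma projection1_innerr (x : G) (z : G1) :
  inner (\val z) (\val (orthogonal_projection G1 x)) = inner (\val z) x.
Proof. by rewrite innerC projection1_inner -innerC. Qed.

Lemma projection1_linear : linear (orthogonal_projection G1).
Proof.
move=> a x y; apply/val_inj/subr0_eq/inner_self_eq0.
set p := orthogonal_projection G1 _; set q := _ + _ : G1.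
rewrite {2}(_ : \val p - \val q = \val (p - q)); last by rewrite raddfB.
have -> : \val q = a *: \val (orthogonal_projection G1 x) +
    \val (orthogonal_projection G1 y).
  by rewrite /q raddfD.
by rewrite innerBl projection1_inner !innerE !projection1_inner subrr.
Qed.

Lemma projection2_eq0 (x : G) :
  orthogonal_projection G2 x = 0 <-> exists x1 : G1, x = \val x1.
Proof.
have [_ G12s] := G12; have [x1 [x2 ->]] := G12s x.
rewrite (projection_decomposition x1 x2).2; split=> [->|[y]].
  by exists x1; rewrite raddf0 addr0.
move=> /(canRL (addKr _)); rewrite addrC -raddfB => x2E.
have := (projection_decomposition (y - x1) 0).2.
rewrite raddf0 addr0 -x2E => <-.
by apply/esym; have := (projection_decomposition 0 x2).2; rewrite raddf0 add0r.
Qed.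

Lemma orthogonal1_in2 (x : G) :
  (forall z : G1, inner (\val z) x = 0) -> exists x2 : G2, x = \val x2.
Proof.
have [G12o G12s] := G12; have [x1 [x2 ->]] := G12s x => x0; exists x2.
have /inner_self_eq0 -> : inner (\val x1) (\val x1) = 0.
  by have := x0 x1; rewrite innerDr G12o addr0.
by rewrite add0r.
Qed.

End OrthogonalDecomposition.

(** * The reduced boundary relation *)

Section Reduction.
Context {R : realType} {H G : hilbertType R} {S : set (H * H)}.
Context {Gamma : set ((H * H) * (G * G))} {G1 G2 : closed_subspace G}.
Hypothesis linGamma : linear_relation Gamma.
Hypothesis domGamma : rel_dom Gamma `<=` adjoint S.
Hypothesis GammaB : conditions_B Gamma.
Hypothesis G12 : orthogonal_decomposition G1 G2.

Local Notation H1 := (reduced_relation S Gamma G2).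
Local Notation Gamma1 := (reduced_boundary_relation Gamma G1).
Local Notation A0 := (rel_ker (Gamma0 Gamma)).
Local Notation T1 := (rel_dom Gamma1).

Lemma reduced_domP f :
  T1 f <-> exists (h : G1) (h' : G), Gamma (f, (\val h, h')).
Proof.
split=> [[[h k] [h' [fh _]]]|[h [h' fh]]]; first by exists h, h'.
by exists (h, orthogonal_projection G1 h'), h'.
Qed.

Lemma reduced_linear : linear_relation Gamma1.
Proof.
split=> [|a [f [h k]] [g [h2 k2]] [h' /= [fh ->]] [k' /= [gk ->]]].
  exists 0; split; first by rewrite raddf0; exact: linear_subspace0 linGamma.
  apply/esym/(projection_unique _ _ 0) => z.
  by rewrite (_ : \val (0 : G1) = 0)// subrr inner0l.
exists (a *: h' + k'); split; last by rewrite /= (projection1_linear G12).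
exact: (linear_subspaceP linGamma a fh gk).
Qed.

Lemma reduced_green : green_identity Gamma1.
Proof.
move=> [[f f'] [h k]] [[g g'] [h2 k2]] [h' /= [fh ->]] [k' /= [gk ->]].
rewrite (greenP GammaB fh gk) !inner_val.
rewrite (projection1_inner G12); congr (_ - _).
exact/esym/(projection1_innerr G12).
Qed.

Lemma reduced_ran : rel_ran (Gamma0 Gamma1) = setT.
Proof.
apply/seteqP; split=> // h _.
have [f [f' [h' fh]]] := Gamma0_surjective GammaB (\val h).
by exists (f, f'), (orthogonal_projection G1 h'), h'.
Qed.

Lemma reduced_ker : rel_ker (Gamma0 Gamma1) = A0.
Proof.
apply/seteqP; split=> f.
  by move=> [k [h' /= [fh _]]]; exists h'.
by move=> [h' fh]; exists (orthogonal_projection G1 h'), h'.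
Qed.

Lemma reduced_conditions_B : conditions_B Gamma1.
Proof.
split; [exact: reduced_green|exact: reduced_ran|].
by rewrite reduced_ker; exact: ker_selfadjoint GammaB.
Qed.

Lemma ker_sub_dom : A0 `<=` T1.
Proof. by move=> f [h' fh]; apply/reduced_domP; exists 0, h'. Qed.

(** An element of [adjoint T1] lies in [adjoint A0 = A0], hence has a boundary
    value [(0, h')], and Green's identity then says that [h'] is orthogonal to
    [G1]. *)
Lemma reduced_relation_adjoint : H1 = adjoint T1.
Proof.
apply/seteqP; split=> -[f f'] fP.
  case: fP => _ [k fk] [g g'] /reduced_domP[h [h' gh]] /=.
  apply/eqP; rewrite -subr_eq0 (greenP GammaB gh fk).
  by rewrite inner0r sub0r oppr_eq0 (proj1 G12).
have [h' fh] : A0 (f, f').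
  rewrite (ker_selfadjoint GammaB) => p /ker_sub_dom; exact: fP.
have [z|k kE] := orthogonal1_in2 G12 h'.
  have [g [g' [k gk]]] := Gamma0_surjective GammaB (\val z).
  have := greenP GammaB gk fh.
  have -> : inner g' f = inner g f'.
    by apply: (fP (g, g')); apply/reduced_domP; exists z, k.
  by rewrite subrr inner0r sub0r => /eqP; rewrite eq_sym oppr_eq0 => /eqP.
split; first by apply: domGamma; exists (0, h').
by exists k; rewrite -kE.
Qed.

Lemma dom_sub_adjoint : T1 `<=` adjoint H1.
Proof.
move=> [g g'] T1g [f f']; rewrite reduced_relation_adjoint => /(_ _ T1g) /= fg.
by rewrite innerC -fg -innerC.
Qed.

Lemma dom_linear : linear_subspace T1.
Proof.
split=> [|a f g [h fh] [k gk]].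
  by exists 0; exact: linear_subspace0 reduced_linear.
by exists (a *: h + k); exact: (linear_subspaceP reduced_linear a fh gk).
Qed.

(** Subtracting from an element of [adjoint H1] a suitable element of [A0]
    leaves an element [(x, 'i *: x)], so it suffices to approximate [x] by the
    eigenvectors of [T1] at ['i]. If [g] is orthogonal to those, the solution
    [(d, d')] in [A0] of [d' - 'i^* *: d = g] has its boundary value orthogonal
    to [G1], that is, it lies in [H1]; this makes [g] orthogonal to [x]. *)
Lemma dom_dense : adjoint H1 `<=` closure T1.
Proof.
move=> [f f'] H1f.
have iNR := @nonreal_i R.
have [e [e' [A0e ef]]] :=
  selfadjoint_range _ 'i (f' - 'i *: f) (ker_selfadjoint GammaB) iNR.
pose x := f - e.
have f'E : f' - e' = 'i *: x.
  apply: eq_inner => z; have := congr1 (fun y => inner y z) ef.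
  rewrite /x !innerE => E; apply/eqP; rewrite -subr_eq0.
  apply/eqP; move/eqP: E; rewrite -subr_eq0 => /eqP E.
  by rewrite -[RHS]oppr0 -E; ring.
have H1x : adjoint H1 (x, 'i *: x).
  rewrite -f'E.
  apply: (linear_subspaceB (adjoint_linear H1) (y := (e, e')) H1f).
  exact/dom_sub_adjoint/ker_sub_dom.
pose L : set H := [set g | T1 (g, 'i *: g)].
have linL : linear_subspace L by exact/eigen_linear/dom_linear.
have /closureP Lx : closure L x.
  apply: closure_of_orthogonal => // g Lg.
  have [d [d' [[m dm] dg]]] := selfadjoint_range _ _ g
    (ker_selfadjoint GammaB) (nonreal_conj iNR).
  have [z|k mE] := orthogonal1_in2 G12 m.
    have [y [h' yh]] := weyl_solution linGamma GammaB 'i (\val z) iNR.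
    have : inner y g = 0 by apply: Lg; apply/reduced_domP; exists z, h'.
    rewrite -dg !innerE conjCK => /eqP; rewrite subr_eq0 => /eqP yd.
    have := greenP GammaB yh dm.
    rewrite yd !innerE subrr sub0r => /eqP.
    by rewrite eq_sym oppr_eq0 => /eqP.
  have H1d : H1 (d, d').
    split; first by apply: domGamma; exists (0, m).
    by exists k; rewrite -mE.
  apply: inner_sym0; have := H1x _ H1d.
  by rewrite -dg !innerE => /= ->; ring.
apply/closure_prodP => c c0.
have [y Ly xy] := Lx _ c0.
exists (e + y, e' + 'i *: y); split => /=.
- apply: (linear_subspaceD dom_linear (x := (e, e')) (y := (y, 'i *: y))) => //.
  exact: ker_sub_dom.
- by rewrite opprD addrA.
- by rewrite opprD addrA f'E -scalerBr normrZ normCi mul1r.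
Qed.

(** With [(e, e')] an element of boundary value [k], the difference
    [(g - e, g' - e')] is in [adjoint A0 = A0], so [((g, g'), (k, m + n))] is in
    [Gamma] for some [m + n], and Green's identity against the elements with
    boundary value in [G1] shows that [k'] is the projection of [m + n]. *)
Lemma reduced_maximal q : (forall p, Gamma1 p -> green p q) -> Gamma1 q.
Proof.
case: q => -[g g'] [k k'] gP.
have [e [e' [m em]]] := Gamma0_surjective GammaB (\val k).
have gP' f f' (h : G1) h' : Gamma ((f, f'), (\val h, h')) ->
    inner f' (g - e) - inner f (g' - e') =
    inner (\val h) m - inner (\val h) (\val k').
  move=> fh.
  have /gP /= : Gamma1 ((f, f'), (h, orthogonal_projection G1 h')) by exists h'.
  rewrite !inner_val (projection1_inner G12) => gE.
  have eE := greenP GammaB fh em.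
  have -> : inner f' (g - e) - inner f (g' - e') =
      (inner f' g - inner f g') - (inner f' e - inner f e').
    by rewrite !innerE; ring.
  by rewrite gE eE /=; ring.
have [n gn] : A0 (g - e, g' - e').
  rewrite (ker_selfadjoint GammaB) => -[f f'] [h' fh] /=.
  apply/eqP; rewrite -subr_eq0 (gP' _ _ 0 h') raddf0 ?inner0l ?subrr//.
exists (m + n); split=> /=.
  suff -> : ((g, g'), (\val k, m + n)) =
      ((e, e'), (\val k, m)) + ((g - e, g' - e'), (0, n)) :> (H * H) * (G * G).
    exact: (linear_subspaceD linGamma em gn).
  by congr (_, _); congr (_, _); rewrite /= ?addr0// addrC subrK.
apply/esym/projection_unique => z; apply/inner_sym0.
have [f [f' [h' fh]]] := Gamma0_surjective GammaB (\val z).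
have := gP' _ _ _ _ fh; rewrite (greenP GammaB fh gn).
rewrite !innerE => /eqP; rewrite -subr_eq0 => /eqP E.
by rewrite -[RHS]oppr0 -E; ring.
Qed.

End Reduction.

Theorem proposition5p1 (R : realType) (H G : hilbertType R)
  (H_separable : separable H)
  (S : set (H * H)) (S_closed_symmetric : closed_symmetric_relation S)
  (S_operator : is_operator S)
  (Gamma : set ((H * H) * (G * G)))
  (Gamma_boundary : boundary_relation S Gamma)
  (Gamma_B : conditions_B Gamma)
  (G1 G2 : closed_subspace G) (G12 : orthogonal_decomposition G1 G2) :
  let H1 := reduced_relation S Gamma G2 in
  let Gamma1 := reduced_boundary_relation Gamma G1 in
  [/\ (* (i) *)
      closed_symmetric_relation H1 /\ equal_defect_numbers H1,
      (* (ii) *)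
      boundary_relation H1 Gamma1 /\ conditions_B Gamma1,
      (* (iii) *)
      dense_in (rel_dom Gamma1) (adjoint H1) /\
      rel_dom Gamma1 =
        [set f | adjoint S f /\ exists h h' : G,
           Gamma (f, (h, h')) /\ orthogonal_projection G2 h = 0] &
      (* (iv) *)
      forall l : R[i], l \isn't Num.real ->
      exists (gamma : G -> H) (M : G -> G),
        [/\ bounded_operator gamma /\ gamma_field Gamma l = graph gamma,
            bounded_operator M /\ weyl_family Gamma l = graph M,
            bounded_operator (fun h : G1 => gamma (\val h)) /\
              gamma_field Gamma1 l = graph (fun h : G1 => gamma (\val h)) &
            bounded_operator (block G1 G1 M) /\
              weyl_family Gamma1 l = graph (block G1 G1 M)]].
Proof.
move=> H1 Gamma1.
have [linGamma [domGamma _] _ _] := Gamma_boundary.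
have linG1 : linear_relation Gamma1 := reduced_linear linGamma G12.
have B1 : conditions_B Gamma1 := reduced_conditions_B Gamma_B G12.
have H1E : H1 = adjoint (rel_dom Gamma1) :=
  reduced_relation_adjoint domGamma Gamma_B G12.
have dense1 : dense_in (rel_dom Gamma1) (adjoint H1).
  split; first exact: dom_sub_adjoint domGamma Gamma_B G12.
  exact: dom_dense linGamma domGamma Gamma_B G12.
have H1A : H1 `<=` rel_ker (Gamma0 Gamma).
  by move=> f [_ [h' fh]]; exists (\val h').
split.
- split; last first.
    exact: selfadjoint_extension_equal_defect H1A (ker_selfadjoint Gamma_B).
  split; [rewrite H1E; exact: adjoint_linear|rewrite H1E; exact: adjoint_closed|].
  move=> f H1f g H1g.
  exact: (ker_symmetric Gamma_B _ (H1A _ H1f) _ (H1A _ H1g)).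
- split=> //; split=> //; first by case: B1.
  exact: reduced_maximal linGamma Gamma_B G12.
- split=> //; apply/seteqP; split=> f.
    move=> /reduced_domP[h [h' fh]].
    split; first by apply: domGamma; exists (\val h, h').
    by exists (\val h), h'; split=> //; apply/(projection2_eq0 G12); exists h.
  move=> [_ [h [h' [fh /(projection2_eq0 G12)[k hk]]]]].
  by apply/reduced_domP; exists k, h'; rewrite -hk.
- move=> l lNR.
  have [gamma [M [bg gE bM ME]]] := weyl_bounded linGamma Gamma_B l lNR.
  have [gamma1 [M1 [bg1 g1E bM1 M1E]]] := weyl_bounded linG1 B1 l lNR.
  have gamma1E : gamma1 = fun h => gamma (\val h).
    apply/funext => h.
    have : gamma_field Gamma1 l (h, gamma1 h) by rewrite g1E.
    move=> [_ [h' [/= fh _]]].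
    suff : gamma_field Gamma l (\val h, gamma1 h) by rewrite gE.
    by exists h'.
  have M1block : M1 = block G1 G1 M.
    apply/funext => h.
    have : weyl_family Gamma1 l (h, M1 h) by rewrite M1E.
    move=> [f [h' [/= fh ->]]]; congr orthogonal_projection.
    suff : weyl_family Gamma l (\val h, h') by rewrite ME.
    by exists f.
  by exists gamma, M; split=> //; rewrite -?gamma1E -?M1block.
Qed.
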